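(* Let $n,k,\ell$ be positive integers, and let $\Gamma=\mathrm{Cay}(\mathbb{Z}_n,\{x^k,x^{-k},x^\ell,x^{-\ell}\})$ be a connected circulant quartic graph. Then: (i) If $k\equiv1\pmod 5$ and $\ell\equiv2\pmod 5$, or $\ell\equiv1\pmod 5$ and $k\equiv2\pmod 5$, then $\Gamma$ contains a $(1,2)$-regular set if and only if $n$ is a multiple of $5$. (ii) If $k\equiv1\pmod 5$ and $\ell\equiv1\pmod 5$, then $\Gamma$ contains no $(1,2)$-regular set. (iii) If $k\equiv1\pmod 5$ and $\ell\equiv0\pmod 5$, or $\ell\equiv1\pmod 5$ and $k\equiv0\pmod 5$, then $\Gamma$ contains no $(1,2)$-regular set.
   Context: $\mathbb{Z}_n=\langle x\rangle$ denotes the cyclic group of order $n$, written multiplicatively. For a finite group $G$ with identity $e$ and an inverse-closed subset $S\subseteq G\setminus\{e\}$, the Cayley graph $\mathrm{Cay}(G,S)$ is the simple graph with vertex set $G$ in which $y$ and $z$ are adjacent if and only if $y^{-1}z\in S$. A circulant quartic graph is a graph $\mathrm{Cay}(\mathbb{Z}_n,\{x^k,x^{-k},x^\ell,x^{-\ell}\})$ where $x^k,x^{-k},x^\ell,x^{-\ell}$ are four distinct non-identity elements. For a graph $\Gamma$ and nonnegative integers $a,b$, a nonempty proper subset $C$ of $V(\Gamma)$ is an $(a,b)$-regular set of $\Gamma$ if every vertex in $C$ has exactly $a$ neighbours in $C$ and every vertex in $V(\Gamma)\setminus C$ has exactly $b$ neighbours in $C$. *)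

(* Defs.v *)
From mathcomp Require Import all_boot all_fingroup.

Set Implicit Arguments.
Unset Strict Implicit.
Unset Printing Implicit Defensive.

Local Open Scope group_scope.

(* A graph on a finite vertex type T is given by its adjacency relation; it is
   simple when the relation is symmetric and irreflexive. *)
Definition simple_graph (T : finType) (e : rel T) : Prop :=
  symmetric e /\ irreflexive e.

Definition connected_graph (T : finType) (e : rel T) : Prop :=
  forall y z : T, connect e y z.

Definition regular_set (T : finType) (e : rel T) (a b : nat) (C : {set T}) :
  Prop :=
  [/\ C != set0, C != [set: T],
      forall y, y \in C -> #|[set z in C | e y z]| = a
    & forall y, y \notin C -> #|[set z in C | e y z]| = b].

Definition Cay (gT : finGroupType) (S : {set gT}) : rel gT :=
  fun y z => y^-1 * z \in S.

Lemma Cay_simple (gT : finGroupType) (S : {set gT}) :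
  1 \notin S -> (forall s, s \in S -> s^-1 \in S) -> simple_graph (Cay S).
Proof.
move=> S1 SV; split=> [y z|y]; last by rewrite /Cay mulVg (negbTE S1).
by apply/idP/idP => /SV; rewrite invMg invgK.
Qed.

Definition circulant_set (gT : finGroupType) (x : gT) (k l : nat) : {set gT} :=
  [set x ^+ k; x ^- k; x ^+ l; x ^- l].

Definition four_distinct_nonid (gT : finGroupType) (x : gT) (k l : nat) : bool :=
  uniq [:: x ^+ k; x ^- k; x ^+ l; x ^- l]
  && (1 \notin circulant_set x k l).

Lemma circulant_simple (gT : finGroupType) (x : gT) (k l : nat) :
  four_distinct_nonid x k l -> simple_graph (Cay (circulant_set x k l)).
Proof.
case/andP=> _ S1; apply: Cay_simple S1 _ => s; rewrite !inE.
by case/orP=> [/orP[/orP[]|]|] /eqP ->; rewrite ?invgK eqxx ?orbT.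
Qed.

(* Main.v *)
Require Import Defs.
From HB Require Import structures.
From mathcomp Require Import all_boot all_fingroup all_algebra.
From mathcomp Require Import cyclic zify.

Set Implicit Arguments.
Unset Strict Implicit.
Unset Printing Implicit Defensive.

Local Open Scope group_scope.

(** Let f be the indicator of a (1,2)-regular set C and let T be the sum of
    1, x^k, x^-k, x^l, x^-l in the group ring of Z_n.  Regularity says exactly
    that the closed neighbourhood of every vertex meets C twice, i.e. that the
    convolution T f is the constant 2.  T has five terms, so T maps constants
    to their multiples by 5, and T^5 f = 2 * 5^4.  Modulo 5 the Frobenius gives
    T^5 = 1 + x^5k + x^-5k + x^5l + x^-5l, hence
      f(y) + f(y x^5k) + f(y x^-5k) + f(y x^5l) + f(y x^-5l) = 0 (mod 5).
    The left side is a sum of five numbers in {0,1}, so they are all equal: C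
    is stable under the fifth powers of the four connection elements
    [generator_power5_invariant].  The elements whose fifth power stabilises C
    form a subgroup, since the group is abelian, and by connectedness this is
    the whole group [power5_invariant].

    Everything then follows from C being a union of cosets of the fifth powers.
    If 5 did not divide n, every element would be a fifth power and C would be
    empty or everything [order_dvd5].  In T f = 2 the exponents may be reduced
    modulo 5.  When k = l = 1 modulo 5 the equation at y becomes
    f(y) + 2 f(y x) + 2 f(y x^-1) = 2, and when {k, l} = {0, 1} modulo 5 it becomes
    3 f(y) + f(y x) + f(y x^-1) = 2; either one forces f(y) = 0 for every y,
    which is absurd as C is nonempty.  Conversely, if 5 divides n and
    {k, l} = {1, 2} modulo 5, a closed neighbourhood meets each residue class
    modulo 5 once, so that the union of any two classes is a (1,2)-regular
    set [mod12_regular_set]. *)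

(** * Convolution equations and the Frobenius *)

Section FrobeniusMultiplier.

Import GRing.Theory.
Local Open Scope ring_scope.

Variables (R : comNzRingType) (u : nat -> R).

(** The functional on polynomials that sends 'X^i to u i: it lets {poly R} act
    on sequences by shifts, so that identities between polynomials become
    identities between shifted sums of u. *)
Definition pairing (q : {poly R}) : R := \sum_(i < size q) q`_i * u i.

Lemma pairing_widen m (q : {poly R}) : (size q <= m)%N ->
  pairing q = \sum_(i < m) q`_i * u i.
Proof.
move=> le_qm; rewrite /pairing (big_ord_widen m (fun i => q`_i * u i)) //.
rewrite [RHS](bigID (fun i : 'I_m => i < size q)%N) /=.
rewrite [X in _ + X]big1 ?addr0 // => i.
by rewrite -leqNgt => le_qi; rewrite nth_default ?mul0r.
Qed.

Lemma pairing_is_linear : linear_for *%R pairing.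
Proof.
move=> a p q; pose m := maxn (size (a *: p + q)) (maxn (size p) (size q)).
rewrite !(@pairing_widen m) ?leq_max ?leqnn ?orbT //.
rewrite mulr_sumr -big_split; apply: eq_bigr => i _.
by rewrite coefD coefZ mulrDl mulrA.
Qed.

HB.instance Definition _ :=
  GRing.isLinear.Build R {poly R} R *%R pairing pairing_is_linear.

Lemma pairingXn i : pairing 'X^i = u i.
Proof.
rewrite /pairing size_polyXn big_ord_recr /= coefXn eqxx mul1r big1 ?add0r //.
by move=> j _; rewrite coefXn (ltn_eqF (ltn_ord j)) mul0r.
Qed.

(** A polynomial acts on a constant sequence through its value at 1. *)
Lemma pairing_mul (s : seq nat) (c : R) (q : {poly R}) :
  (forall i, \sum_(e <- s) u (i + e) = c) ->
  pairing (q * \sum_(e <- s) 'X^e) = q.[1] * c.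
Proof.
move=> sum_u; rewrite -{1}[q]coefK poly_def mulr_suml raddf_sum /=.
rewrite horner_coef mulr_suml; apply: eq_bigr => i _.
rewrite expr1n mulr1 -scalerAl linearZ /= [X in pairing X]mulr_sumr raddf_sum /=.
by under eq_bigr do rewrite -exprD pairingXn; rewrite sum_u.
Qed.

(** With T the sum of the 'X^e, the p-th power of T both is the sum of the
    'X^(e * p), by the Frobenius, and sends u to c times the value of
    T ^+ p.-1 at 1, which is a positive power of (size s)%:R = 0. *)
Lemma sum_shift_Frobenius (p : nat) (s : seq nat) (c : R) :
    p \in [pchar R] -> (p %| size s)%N ->
    (forall i, \sum_(e <- s) u (i + e) = c) ->
  \sum_(e <- s) u (e * p) = 0.
Proof.
move=> pcharRp p_dvd sum_u.
have pcharXp : p \in [pchar {poly R}] by rewrite pchar_poly.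
pose T : {poly R} := \sum_(e <- s) 'X^e.
have TpE : T ^+ p = \sum_(e <- s) 'X^(e * p).
  rewrite -(pFrobenius_autE pcharXp) raddf_sum /=.
  by apply: eq_bigr => e _; rewrite pFrobenius_autE -exprM.
have T1 : T.[1] = 0.
  rewrite horner_sum; under eq_bigr do rewrite hornerXn expr1n.
  rewrite big_const_seq count_predT iter_addr_0.
  by apply/eqP; rewrite -(dvdn_pcharf pcharRp).
transitivity (pairing (T ^+ p)).
  by rewrite TpE raddf_sum; apply: eq_bigr => e _; rewrite /= pairingXn.
rewrite -(prednK (prime_gt0 (pcharf_prime pcharRp))) exprSr (pairing_mul _ sum_u).
rewrite horner_exp T1 expr0n /= -subn1 subn_eq0 leqNgt.
by rewrite (prime_gt1 (pcharf_prime pcharRp)) mul0r.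
Qed.

End FrobeniusMultiplier.

(** * Regular sets of circulant graphs *)

Lemma dvd5_sum_bool (b1 b2 b3 b4 b5 : bool) :
  5 %| b1 + (b2 + (b3 + (b4 + b5))) -> [/\ b2 = b1, b3 = b1, b4 = b1 & b5 = b1].
Proof. by case: b1 b2 b3 b4 b5 => [] [] [] [] []. Qed.

Lemma card_Cay_neighbours (gT : finGroupType) (S C : {set gT}) (y : gT) :
  #|[set z in C | Cay S y z]| = \sum_(s in S) (y * s \in C)%g.
Proof.
rewrite -sum1dep_card big_mkcond (reindex_inj (mulgI y)) [RHS]big_mkcond /=.
by apply: eq_bigr => s _; rewrite /Cay mulKg; case: (_ \in C); case: (s \in S).
Qed.

Section CirculantRegularSets.

Variables (gT : finGroupType) (x : gT) (k l : nat).
Hypothesis quartic : four_distinct_nonid x k l.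
Let S := circulant_set x k l.

Lemma card_circulant_neighbours (C : {set gT}) (y : gT) :
  #|[set z in C | Cay S y z]| =
    (y * x ^+ k \in C) + ((y * x ^- k \in C) +
      ((y * x ^+ l \in C) + (y * x ^- l \in C))).
Proof.
case/andP: quartic => uniq_s _; rewrite card_Cay_neighbours.
rewrite (eq_bigl [in [:: x ^+ k; x ^- k; x ^+ l; x ^- l]]); last first.
  by move=> s; rewrite !inE -!orbA.
by rewrite -big_uniq //= !big_cons big_nil addn0.
Qed.

Section FifthPowers.

Variable C : {set gT}.
Hypothesis regC : regular_set (Cay S) 1 2 C.

(** The values 1 on C and 2 off C merge into one equation once y itself is
    counted: this is what makes the condition linear in the indicator of C. *)
Lemma closed_neighbourhood_sum (y : gT) :
  (y \in C) + ((y * x ^+ k \in C) + ((y * x ^- k \in C) +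
    ((y * x ^+ l \in C) + (y * x ^- l \in C)))) = 2.
Proof.
case: regC => _ _ inC outC; rewrite -card_circulant_neighbours.
by case: (boolP (y \in C)) => yC; [rewrite inC | rewrite outC].
Qed.

(** Since the five memberships on the left of the closed neighbourhood equation
    sum to 0 modulo 5 when the connection elements are replaced by their fifth
    powers, they are all true or all false. *)
Lemma generator_power5_invariant (s y : gT) :
  s \in S -> (y * s ^+ 5 \in C) = (y \in C).
Proof.
(* Polynomial exponents are natural numbers: x ^- j is x ^+ (N * j). *)
pose N := #[x].-1; pose es := [:: 0; k; N * k; l; N * l]%N.
have xN j : x ^+ (N * j) = x ^- j by rewrite expgM -invg_expg expVgn.
pose u i : 'F_5 := (y * x ^+ i \in C)%g%:R%R.
have sum_u i : (\sum_(e <- es) u (i + e)%N = 2%:R)%R.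
  rewrite !big_cons big_nil /u addn0 GRing.addr0 !expgD !mulgA !xN -!GRing.natrD.
  by rewrite closed_neighbourhood_sum.
have:= sum_shift_Frobenius (pchar_Fp (isT : prime 5)) (isT : 5 %| size es) sum_u.
rewrite !big_cons big_nil /u GRing.addr0 mul0n expg0 mulg1.
rewrite !(expgM x _ 5) !xN -!GRing.natrD.
move/eqP; rewrite -(GRing.dvdn_pcharf (pchar_Fp (isT : prime 5))).
case/dvd5_sum_bool=> Ek EVk El EVl.
by rewrite !inE -!orbA => /or4P[] /eqP->.
Qed.

Hypothesis x_gen : <[x]> = [set: gT].
Hypothesis conn : connected_graph (Cay S).

(** Fifth powering is multiplicative here, so the invariance extends from the
    connection elements to the endpoint of any walk from 1. *)
Lemma power5_invariant (g y : gT) : (y * g ^+ 5 \in C) = (y \in C).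
Proof.
have comm (a b : gT) : commute a b.
  by apply: (centsP (cycle_abelian x)); rewrite x_gen inE.
suff step p a : path (Cay S) a p ->
    (forall z, (z * a ^+ 5 \in C) = (z \in C)) ->
    forall z, (z * last a p ^+ 5 \in C) = (z \in C).
  have /connectP[p path_p ->] := conn 1 g.
  by apply: step path_p _ y => z; rewrite expg1n mulg1.
elim: p a => [|b p IHp] a //= /andP[ab path_p] inv_a; apply: IHp path_p _ => z.
rewrite -[b](mulKVg a) expgMn; last exact: comm.
by rewrite mulgA generator_power5_invariant ?inv_a.
Qed.

Lemma power_mod5_invariant (g y : gT) (i : nat) :
  (y * g ^+ i \in C) = (y * g ^+ (i %% 5) \in C).
Proof. by rewrite {1}(divn_eq i 5) addnC expgD expgM mulgA power5_invariant. Qed.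

Lemma closed_neighbourhood_sum_mod5 (y : gT) :
  (y \in C) + ((y * x ^+ (k %% 5) \in C) + ((y * x ^- (k %% 5) \in C) +
    ((y * x ^+ (l %% 5) \in C) + (y * x ^- (l %% 5) \in C)))) = 2.
Proof.
rewrite -!expVgn -!power_mod5_invariant !expVgn; exact: closed_neighbourhood_sum.
Qed.

(** If 5 is prime to the order, every element is a fifth power, and C, being nonempty, is the
    whole group. *)
Lemma order_dvd5 : 5 %| #[x].
Proof.
apply: contraT => ndvd5; case: regC => /set0Pn[c cC] /negP C_T _ _; case: C_T.
have co5 : coprime #|[set: gT]| 5.
  by rewrite -x_gen -orderE coprime_sym prime_coprime.
apply/eqP/setP=> y; rewrite inE -[y](mulKVg c).
rewrite -(expgK co5 (in_setT (c^-1 * y))) expgAC.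
by rewrite power5_invariant.
Qed.

End FifthPowers.

(** The residues 0, 1, -1, 2, -2 represent each class modulo 5 once, so a
    closed neighbourhood meets two classes, here those of 0 and 1, exactly
    twice. *)
Lemma mod12_regular_set :
    <[x]> = [set: gT] -> 5 %| #[x] ->
    (k = 1 %[mod 5] /\ l = 2 %[mod 5]) \/ (l = 1 %[mod 5] /\ k = 2 %[mod 5]) ->
  exists C : {set gT}, regular_set (Cay S) 1 2 C.
Proof.
move=> x_gen dvd5 kl12.
pose C := [set x ^+ (i : nat) | i : 'I_#[x] & i %% 5 < 2].
have inC i : (x ^+ i \in C) = (i %% 5 < 2).
  apply/imsetP/idP=> [[j] | i_lt2].
    rewrite inE => j_lt2 /eqP; rewrite eq_expg_mod_order => /eqP eq_ij.
    by rewrite -(modn_dvdm _ dvd5) eq_ij modn_dvdm.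
  exists (Ordinal (ltn_pmod i (order_gt0 x))); first by rewrite inE /= modn_dvdm.
  by rewrite /= expg_mod_order.
pose N := #[x].-1.
have xN j : x ^- j = x ^+ (N * j) by rewrite expgM -invg_expg expVgn.
have N4 : N %% 5 = 4.
  by have:= order_gt0 x; rewrite /N; lia.
exists C.
have sumC y : (y \in C) + #|[set z in C | Cay S y z]| = 2.
  have: y \in <[x]> by rewrite x_gen inE.
  case/cycleP=> i ->; rewrite card_circulant_neighbours !xN -!expgD !inC.
  rewrite -(modnDm i k) -(modnDm i l) -(modnDm i (N * k)%N) -(modnDm i (N * l)%N).
  rewrite -(modnMm N k) -(modnMm N l) N4.
  have: i %% 5 < 5 by rewrite ltn_pmod.
  by case: kl12 => -[-> ->]; case: (i %% 5) => [|[|[|[|[|]]]]].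
split.
- by apply/set0Pn; exists (x ^+ 0); rewrite inC.
- by apply/eqP=> C_T; have:= inC 2; rewrite C_T inE.
- by move=> y yC; have:= sumC y; rewrite yC => -[].
- by move=> y /negbTE yC; have:= sumC y; rewrite yC.
Qed.

End CirculantRegularSets.

Theorem theorem6p3p8 (n k l : nat) (n_gt0 : (0 < n)%N) (k_gt0 : (0 < k)%N)
    (l_gt0 : (0 < l)%N)
    (gT : finGroupType) (x : gT)
    (x_gen : <[x]> = [set: gT]) (x_order : #[x] = n)
    (quartic : four_distinct_nonid x k l)
    (conn : connected_graph (Cay (circulant_set x k l))) :
  [/\ (k = 1 %[mod 5] /\ l = 2 %[mod 5]) \/ (l = 1 %[mod 5] /\ k = 2 %[mod 5]) ->
        ((exists C : {set gT}, regular_set (Cay (circulant_set x k l)) 1 2 C)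
          <-> 5 %| n),
      k = 1 %[mod 5] /\ l = 1 %[mod 5] ->
        ~ exists C : {set gT}, regular_set (Cay (circulant_set x k l)) 1 2 C
    & (k = 1 %[mod 5] /\ l = 0 %[mod 5]) \/ (l = 1 %[mod 5] /\ k = 0 %[mod 5]) ->
        ~ exists C : {set gT}, regular_set (Cay (circulant_set x k l)) 1 2 C].
Proof.
have empty (C : {set gT}) : regular_set (Cay (circulant_set x k l)) 1 2 C ->
    ~ forall y, y \notin C.
  by case=> /set0Pn[c cC] _ _ _ /(_ c); rewrite cC.
split.
- move=> kl12; split=> [[C regC] | dvd5].
    by rewrite -x_order; apply: order_dvd5 regC x_gen conn.
  by apply: mod12_regular_set kl12; rewrite // x_order.
(* f(y) + 2 (f(y x) + f(y x^-1)) = 2 forces f(y) to be even. *)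
- case=> k1 l1 [C regC]; apply: (empty C regC) => y.
  have:= closed_neighbourhood_sum_mod5 quartic regC x_gen conn y.
  by rewrite k1 l1; do 3!case: (_ \in C).
(* 3 f(y) + f(y x) + f(y x^-1) = 2 forces f(y) = 0, as 3 > 2. *)
- move=> kl10 [C regC]; apply: (empty C regC) => y.
  have:= closed_neighbourhood_sum_mod5 quartic regC x_gen conn y.
  case: kl10 => -[-> ->]; rewrite !expg0 ?invg1 ?mulg1; by do 3!case: (_ \in C).
Qed.
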